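(* Let $\alpha\in(0,1)$, let $C_\alpha\subset[0,1]$ be the central Cantor set with parameter $\alpha$, and let the positive integers $k_\alpha$ and $t_\alpha$ be those associated with $\alpha$ in the context. Let $$\Gamma_\alpha=\left\{\prod_{k=1}^{2t_\alpha}c_k : c_k\in C_\alpha \text{ for } k=1,\dots,2t_\alpha\right\}$$ and $$I_\alpha=\left[\left(1-\Big(\frac{1-\alpha}{2}\Big)^{k_\alpha}\right)^{t_\alpha+1},\ \left(1-\Big(\frac{1-\alpha}{2}\Big)^{k_\alpha}\right)^{t_\alpha-1}\right].$$ Then $I_\alpha\subset\Gamma_\alpha$.
   Context: Central Cantor set. For $\alpha\in(0,1)$, $C_\alpha=\bigcap_{l\ge 1}C_l$, where $C_0=[0,1]$ and, for $l\ge 1$, $C_l$ is obtained from $C_{l-1}$ (a disjoint union of $2^{l-1}$ closed intervals of equal length) by removing from each of these closed intervals the open interval with the same centre and with length $\alpha$ times the length of that closed interval. The integer $k_\alpha$. If $\alpha\le 1/3$: let $a_0>1$ be the real number such that the graph of $t\mapsto a_0^{2t-1}$ is tangent to the line $y=t-1$, and set $$k_\alpha=\left\lceil\frac{\log(1-\frac{1}{a_0})}{\log(\frac{1-\alpha}{2})}\right\rceil.$$ If $\alpha>1/3$: set $\beta_\alpha=\frac{1-\alpha^2}{6\alpha-1-\alpha^2}$, let $a_1>1$ be the real number such that the graph of $t\mapsto a_1^{2t-1}$ is tangent to the line $y=\beta_\alpha(t-3)$ (equivalently $a_1^5\log a_1=\frac{\beta_\alpha}{2e}$), and set $$k_\alpha=\left\lceil\frac{\log(1-\frac{1}{a_1})}{\log(\frac{1-\alpha}{2})}\right\rceil.$$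 The integer $t_\alpha$. Write $\theta_\alpha=1-\left(\frac{1-\alpha}{2}\right)^{k_\alpha}$. Then $t_\alpha$ is the smallest positive integer $t$ satisfying $$t=\left\lceil\frac{1}{\theta_\alpha^{2t-1}}\right\rceil\quad\text{if }\alpha\le 1/3,\qquad t=\left\lceil\frac{1}{\theta_\alpha^{2t-1}}\right\rceil+\left\lceil\frac{\frac{3\alpha-1}{2}}{\theta_\alpha^{2t-1}\cdot\frac{1-\alpha^2}{4}}\right\rceil\quad\text{if }\alpha>1/3.$$ With this choice of $k_\alpha$ such an integer exists. *)

(* Defs.v *)
From HB Require Import structures.
From mathcomp Require Import all_boot all_order all_algebra.
From mathcomp Require Import all_classical all_reals all_analysis.
From mathcomp Require Import lra.
Set Implicit Arguments.
Unset Strict Implicit.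
Unset Printing Implicit Defensive.
Import Order.TTheory GRing.Theory Num.Theory.
Import numFieldNormedType.Exports.
Local Open Scope classical_set_scope.
Local Open Scope ring_scope.

(* A pair J = (a, b) stands for the closed interval [a, b]. *)
Definition removed_gap (R : realType) (alpha : R) (J : R * R) : R * R :=
  let centre := (J.1 + J.2) / 2 in
  let len := alpha * (J.2 - J.1) in
  (centre - len / 2, centre + len / 2).

Definition split_interval (R : realType) (alpha : R) (J : R * R) :
    seq (R * R) :=
  [:: (J.1, (removed_gap alpha J).1); ((removed_gap alpha J).2, J.2)].

Fixpoint cantor_intervals (R : realType) (alpha : R) (l : nat) : seq (R * R) :=
  if l is l'.+1 then flatten
    (map (split_interval alpha) (cantor_intervals alpha l'))
  else [:: (0, 1)].

Definition interval_union (R : realType) (s : seq (R * R)) : set R :=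
  \bigcup_(J in [set` s]) `[J.1, J.2]%classic.

Lemma split_intervalE (R : realType) (alpha : R) (J : R * R) :
  0 < alpha < 1 -> J.1 <= J.2 ->
  interval_union (split_interval alpha J) =
  `[J.1, J.2]%classic `\`
  `](removed_gap alpha J).1, (removed_gap alpha J).2[%classic.
Proof.
case: J => a b /= /andP[al0 al1] ab.
have h0 : 0 <= alpha * (b - a) by apply: mulr_ge0; lra.
have h1 : alpha * (b - a) <= b - a by apply: ler_piMl; lra.
apply/seteqP; split => x.
  move=> [J]; rewrite /= !in_cons in_nil orbF => /orP[] /eqP -> /=;
    rewrite in_itv /= => /andP[xl xr];
    by split; [rewrite /= in_itv /=; lra|rewrite /= in_itv /=; lra].
move=> [] /=; rewrite !in_itv /= => /andP[ax xb] /negP.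
rewrite negb_and -!leNgt => /orP[xg|xg].
  by eexists; [apply: mem_head|rewrite /= in_itv /= ax].
by eexists; [rewrite /= in_cons; apply/orP; right; apply: mem_head
            |rewrite /= in_itv /= xb andbT].
Qed.

Definition cantor_stage (R : realType) (alpha : R) (l : nat) : set R :=
  interval_union (cantor_intervals alpha l).

Definition central_cantor (R : realType) (alpha : R) : set R :=
  \bigcap_(l in [set l : nat | (1 <= l)%N]) cantor_stage alpha l.

Definition tangent_graphs (R : realType) (f g : R -> R) : Prop :=
  exists x : R, [/\ derivable f x 1, derivable g x 1,
                    f x = g x & derive1 f x = derive1 g x].

(* In the definitions by [xget] below the described object exists and is
   unique for every alpha in ]0, 1[ (in ]1/3, 1[ for a1, which is not used
   otherwise), so that the default value 0 is irrelevant. *)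
Definition a0 (R : realType) : R :=
  xget 0 [set a : R | 1 < a /\
    tangent_graphs (fun t => a `^ (2 * t - 1)) (fun t => t - 1)].

Definition beta (R : realType) (alpha : R) : R :=
  (1 - alpha ^+ 2) / (6 * alpha - 1 - alpha ^+ 2).

Definition a1 (R : realType) (alpha : R) : R :=
  xget 0 [set a : R | 1 < a /\
    tangent_graphs (fun t => a `^ (2 * t - 1)) (fun t => beta alpha * (t - 3))].

(* For alpha in ]0, 1[ the ceiling is positive, both logarithms being
   negative, so the absolute value only casts it to nat. *)
Definition k_of (R : realType) (alpha : R) : nat :=
  let a := if alpha <= 1 / 3 then a0 R else a1 alpha in
  `|Num.ceil (ln (1 - 1 / a) / ln ((1 - alpha) / 2))|%N.

Definition theta (R : realType) (alpha : R) : R :=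
  1 - ((1 - alpha) / 2) ^+ k_of alpha.

Definition t_equation (R : realType) (alpha : R) (t : nat) : Prop :=
  let p := theta alpha ^+ (2 * t - 1) in
  t%:Z = if alpha <= 1 / 3 then Num.ceil (1 / p)
         else Num.ceil (1 / p) +
              Num.ceil (((3 * alpha - 1) / 2) / (p * ((1 - alpha ^+ 2) / 4))).

Definition t_of (R : realType) (alpha : R) : nat :=
  xget 0%N [set t : nat | [/\ (0 < t)%N, t_equation alpha t &
    forall s : nat, (0 < s)%N -> t_equation alpha s -> (t <= s)%N]].

Definition Gamma_of (R : realType) (alpha : R) : set R :=
  [set x | exists c : 'I_(2 * t_of alpha) -> R,
     (forall k, central_cantor alpha (c k)) /\ x = \prod_k c k].

Definition I_of (R : realType) (alpha : R) : set R :=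
  `[theta alpha ^+ (t_of alpha + 1), theta alpha ^+ (t_of alpha - 1)]%classic.

(* Main.v *)
Require Import Defs.
From mathcomp Require Import all_boot all_order all_algebra.
From mathcomp Require Import all_classical all_reals all_analysis.
From mathcomp Require Import lra ring.
Import Order.TTheory GRing.Theory Num.Theory.
Import numFieldNormedType.Exports.
Local Open Scope classical_set_scope.
Local Open Scope ring_scope.

(** Write lam = (1 - alpha) / 2 for the contraction ratio of the Cantor set C,
    k for k_alpha, t for t_alpha and th = 1 - lam ^ k.  A stronger fact holds:
    every x in [th ^ (2 t), 1] is a product of 2 t points of C lying in
    [th, 1], the rightmost interval of stage k.

    Products.  Suppose that x lies between the product of the left endpoints
    and the product of the right endpoints of m + 1 construction intervals
    contained in [th, 1].  The intervals are refined one after the other.  When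
    the interval [a, a + l] is split, the two children are [a, a + lam l] and
    [a + (1 - lam) l, a + l], and every other interval still has length at
    least lam l.  If P and Q are the products of the other left and right
    endpoints, then Q >= P (1 + lam l) ^ m >= P (1 + m lam l), and so
    (a + (1 - lam) l) P <= (a + lam l) Q as soon as 1 - 2 lam <= m lam th: the
    products over the two children leave no gap, and one child can be kept
    (lemmas [split_factor] and [split_all]).  Iterating, the left endpoints
    converge to points of C whose product is x (lemma [prod_cantor]).

    The size of t.  Since 1 - 2 lam = alpha, the condition to be checked is
    alpha <= (2 t - 1) lam th.  It follows from th >= 1 - lam (as k >= 1) and
    from the lower bound on t given by the equation that defines t, whose first
    ceiling is at least 2 (lemma [t_of_large]).

    Existence of t.  Let F be the right-hand side of the equation t = F t and
    let a be a_0 or a_1.  The choice of k gives 1 / th <= a.  At the tangency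
    point x the power a ^ (2 x - 1) equals the height of the line, which is low
    enough that n = floor x satisfies F n <= n.  As F is nondecreasing and
    positive, the least positive n with F n <= n is a fixed point (lemmas
    [t_rhs_le] and [prefixpoint_fixpoint]).  The tangent parameter a itself is
    obtained from the intermediate value theorem applied to u = ln a (lemma
    [tangent_exists]). *)

(** * Construction intervals of the central Cantor set *)

(** The contraction ratio of the Cantor set; [theta alpha] is
    [1 - ratio alpha ^+ k_of alpha] by definition. *)
Definition ratio {R : realType} (alpha : R) : R := (1 - alpha) / 2.

(** [a] is the left endpoint of one of the intervals of stage [l], all of which
    have length [ratio alpha ^+ l]. *)
Definition cantor_left {R : realType} (alpha : R) (l : nat) (a : R) : Prop :=
  (a, a + ratio alpha ^+ l) \in cantor_intervals alpha l.

Lemma ratio_bounds {R : realType} (alpha : R) : 0 < alpha < 1 ->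
  0 < ratio alpha < 1 / 2.
Proof. by rewrite /ratio => /andP[? ?]; apply/andP; split; lra. Qed.

(** The boolean selects the left or the right child of the interval. *)
Lemma cantor_left_child {R : realType} (alpha : R) (l : nat) (a : R) (b : bool) :
  cantor_left alpha l a ->
  cantor_left alpha l.+1 (a + b%:R * ((1 - ratio alpha) * ratio alpha ^+ l)).
Proof.
move=> al; apply/flattenP; exists (split_interval alpha (a, a + ratio alpha ^+ l)).
  exact: map_f.
rewrite /split_interval /removed_gap /= !inE exprS.
have e : alpha = 1 - 2 * ratio alpha by rewrite /ratio; field.
set y := ratio alpha ^+ l in al *; rewrite [X in X * (a + y - a)]e.
by case: b => /=; rewrite ?mul1r ?mul0r; apply/orP; [right|left]; apply/eqP; congr pair; field.
Qed.

Lemma cantor_left_rightmost {R : realType} (alpha : R) (l : nat) :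
  cantor_left alpha l (1 - ratio alpha ^+ l).
Proof.
elim: l => [|l /(@cantor_left_child _ _ _ _ true)].
  by rewrite /cantor_left /= inE expr0; apply/eqP; congr pair; ring.
by rewrite /= mul1r exprS; congr cantor_left; ring.
Qed.

(** * Products of points of the Cantor set *)

(** Splitting one factor.  [P] and [Q] are the products of the left and right
    endpoints of the [m] other intervals.  One of the two children of
    [[a, a + l]] still allows the value [x]. *)
Lemma split_factor {R : realType} (m : nat) (lam th a l P Q x : R) :
  0 <= lam -> 0 <= l -> th <= a -> 0 <= P -> 1 - 2 * lam <= m%:R * lam * th ->
  P * (1 + lam * l) ^+ m <= Q ->
  a * P <= x <= (a + l) * Q -> 0 <= a ->
  exists b : bool, let a' := a + b%:R * ((1 - lam) * l) in
    a' * P <= x <= (a' + lam * l) * Q.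
Proof.
move=> lam0 l0 tha P0 hm hPQ /andP[xl xr] a0.
have [xx|xx] := leP x ((a + lam * l) * Q).
  by exists false; rewrite /= mul0r addr0 xl xx.
exists true => /=; rewrite mul1r; apply/andP; split; last first.
  by apply: le_trans xr _; rewrite le_eqVlt; apply/orP; left; apply/eqP; ring.
apply: ltW; apply: le_lt_trans xx.
(* Bernoulli's inequality *)
have bern : 1 + m%:R * (lam * l) <= (1 + lam * l) ^+ m.
  have h : 0 <= lam * l by apply: mulr_ge0.
  elim: m {hm hPQ} => [|m IH]; first by rewrite expr0 mul0r addr0.
  rewrite exprS; apply: (@le_trans _ _ ((1 + lam * l) * (1 + m%:R * (lam * l)))).
    have -> : m.+1%:R = m%:R + 1 :> R by rewrite -natr1.
    have : 0 <= m%:R * (lam * l) * (lam * l) by rewrite !mulr_ge0.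
    by move=> ?; nra.
  by apply: ler_wpM2l => //; lra.
have h1 : P * (1 + m%:R * (lam * l)) <= Q.
  by apply: le_trans hPQ; apply: ler_wpM2l.
apply: (@le_trans _ _ ((a + lam * l) * (P * (1 + m%:R * (lam * l))))); last first.
  by apply: ler_wpM2l => //; apply: addr_ge0 => //; apply: mulr_ge0.
rewrite mulrCA mulrC; apply: ler_wpM2l => //.
have h2 : (1 - 2 * lam) * l <= m%:R * lam * a * l.
  apply: ler_wpM2r => //; apply: le_trans hm _; apply: ler_wpM2l => //.
  exact: mulr_ge0.
have h3 : 0 <= lam * l * (m%:R * (lam * l)) by rewrite !mulr_ge0.
lra.
Qed.

(** Splitting all the factors: [m + 1] intervals of the same length [l] are
    replaced by children of length [lam * l], keeping [x] between the products
    of the endpoints. *)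
Lemma split_all {R : realType} (m : nat) (lam th l x : R) (a : 'I_m.+1 -> R) :
  0 <= lam <= 1 -> 0 <= l -> 0 <= th ->
  1 - 2 * lam <= m%:R * lam * th ->
  (forall i, th <= a i /\ a i + l <= 1) ->
  \prod_i a i <= x <= \prod_i (a i + l) ->
  exists b : 'I_m.+1 -> bool,
    let a' := fun i => a i + (b i)%:R * ((1 - lam) * l) in
    \prod_i a' i <= x <= \prod_i (a' i + lam * l).
Proof.
move=> /andP[lam0 lam1] l0 th0 hm ha hx.
have ll : lam * l <= l by rewrite ler_piMl.
(* The factors are split in order: after [j] steps, those of index below [j]
   have length [lam * l] and the other ones are untouched. *)
suff: forall j : nat, (j <= m.+1)%N -> exists b : 'I_m.+1 -> bool,
    (forall i : 'I_m.+1, (j <= i)%N -> b i = false) /\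
    \prod_i (a i + (b i)%:R * ((1 - lam) * l)) <= x <=
    \prod_i (a i + (b i)%:R * ((1 - lam) * l)
               + (if (i < j)%N then lam * l else l)).
  move=> /(_ m.+1 (leqnn _)) [b [_ hb]]; exists b => /=.
  move/andP: hb => [-> /=]; by under eq_bigr do rewrite ltn_ord.
elim => [_|j IH jm].
  exists (fun=> false); split => //.
  under eq_bigr do rewrite /= mul0r addr0.
  by under [X in _ <= _ <= X]eq_bigr do rewrite /= mul0r addr0.
have [b [bj hb]] := IH (ltnW jm).
pose k := Ordinal jm.
pose a1 i := a i + (b i)%:R * ((1 - lam) * l).
pose e i := if (i < j)%N then lam * l else l.
have e_ge (i : nat) : lam * l <= e i by rewrite /e; case: ifP.
have a1th i : th <= a1 i.
  rewrite /a1; have [h _] := ha i; apply: le_trans h _; rewrite lerDl.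
  by rewrite mulr_ge0 // mulr_ge0 // subr_ge0.
have a1_le i : a1 i <= 1.
  rewrite /a1; have [_ h] := ha i; apply: le_trans h; rewrite lerD2l.
  case: (b i) => /=; rewrite ?mul0r // mul1r mulrBl mul1r gerBl.
  exact: mulr_ge0.
have a1k : a1 k = a k by rewrite /a1 bj //= mul0r addr0.
have ek : e k = l by rewrite /e /= ltnn.
have := @split_factor R m lam th (a k) l (\prod_(i | i != k) a1 i)
   (\prod_(i | i != k) (a1 i + e i)) x lam0 l0.
case=> //.
- by have [] := ha k.
- by apply: prodr_ge0 => i _; exact: le_trans (a1th i).
- have -> : (1 + lam * l) ^+ m = \prod_(i < m.+1 | i != k) (1 + lam * l).
    by rewrite prodr_const cardC1 card_ord.
  rewrite -big_split; apply: ler_prod => i _ /=.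
  have h0 : 0 <= a1 i := le_trans th0 (a1th i).
  have h1 : 0 <= lam * l by apply: mulr_ge0.
  apply/andP; split; first by rewrite mulr_ge0 // addr_ge0.
  rewrite mulrDr mulr1 lerD2l; apply: le_trans (e_ge i).
  by rewrite ler_piMl.
- move: hb; rewrite (bigD1 k) //= [X in _ <= _ <= X -> _](bigD1 k) //=.
  by rewrite -/(a1 k) -/(e k) a1k ek.
- by apply: le_trans th0 _; have [] := ha k.
move=> c hc.
pose b' i := if i == k then c else b i.
exists b'; split.
  move=> i ji; rewrite /b'; case: eqP => [ik|_]; first by rewrite ik /= ltnn in ji.
  by apply: bj; exact: ltnW.
rewrite (bigD1 k) //= [X in _ <= _ <= X](bigD1 k) //=.
rewrite {1 3}/b' !eqxx ltnSn.
under eq_bigr => i ik do rewrite /b' (negbTE ik).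
under [X in _ <= _ <= _ * X]eq_bigr => i ik.
  have ij : (i == j :> nat) = false by apply/negbTE; move: ik; rewrite -val_eqE.
  rewrite /b' (negbTE ik) ltnS leq_eqVlt ij; over.
exact: hc.
Qed.

(** A sequence of intervals with left endpoints [a n] and lengths
    [lam ^+ n * l], each one sharing an endpoint with the previous one, shrinks
    to a common point. *)
Lemma nested_intervals_point {R : realType} (lam l : R) (a : nat -> R) :
  0 <= lam < 1 -> 0 <= l ->
  (forall n, exists b : bool,
     a n.+1 = a n + b%:R * ((1 - lam) * (lam ^+ n * l))) ->
  exists c : R, a @ \oo --> c /\ forall n, a n <= c <= a n + lam ^+ n * l.
Proof.
move=> /andP[lam0 lam1] l0 ha.
have ge0 n : 0 <= lam ^+ n * l by rewrite mulr_ge0 // exprn_ge0.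
have nda : {homo a : n m / (n <= m)%N >-> n <= m}.
  apply/nondecreasing_seqP => n; have [b ->] := ha n.
  by rewrite lerDl mulr_ge0 // mulr_ge0 // subr_ge0 ltW.
have nib : {homo (fun n => a n + lam ^+ n * l) : n m / (n <= m)%N >-> m <= n}.
  apply/nonincreasing_seqP => n; have [b ->] := ha n.
  rewrite exprS; case: b => /=; first by rewrite le_eqVlt; apply/orP; left;
    apply/eqP; ring.
  by rewrite mul0r addr0 lerD2l -mulrA ler_piMl // ltW.
have ub n k : a k <= a n + lam ^+ n * l.
  apply: (@le_trans _ _ (a (maxn n k))); first by apply: nda; exact: leq_maxr.
  apply: (@le_trans _ _ (a (maxn n k) + lam ^+ (maxn n k) * l)).
    by rewrite lerDl.
  by apply: (nib n); exact: leq_maxl.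
exists (sup (range a)); split.
  by apply: nondecreasing_cvgn => //; exists (a 0%N + lam ^+ 0 * l) => _ [k _ <-].
move=> n; apply/andP; split.
  apply: ub_le_sup; last by exists n.
  by exists (a 0%N + lam ^+ 0 * l) => _ [k _ <-].
by apply: ge_sup; [exists (a 0%N), 0%N|move=> _ [k _ <-]].
Qed.

(** Products of [m + 1] points of the Cantor set cover the whole interval
    [[th ^+ m.+1, 1]], where [th] is the left endpoint of the rightmost interval
    of stage [k]. *)
Lemma prod_cantor {R : realType} (alpha : R) (k m : nat) (x : R) :
  0 < alpha < 1 ->
  let th := 1 - ratio alpha ^+ k in
  alpha <= m%:R * ratio alpha * th ->
  th ^+ m.+1 <= x <= 1 ->
  exists c : 'I_m.+1 -> R, (forall i, central_cantor alpha (c i)) /\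
    x = \prod_i c i.
Proof.
move=> alpha01 th; set lam := ratio alpha => hm hx.
have /andP[lam0 lamh] := ratio_bounds _ alpha01; rewrite -/lam in lam0 lamh.
have lam1 : lam < 1 by lra.
have hm' : 1 - 2 * lam <= m%:R * lam * th.
  by rewrite /lam /ratio in hm *; lra.
have lk0 n : 0 <= lam ^+ n by rewrite exprn_ge0 // ltW.
have th0 : 0 <= th by rewrite subr_ge0 exprn_ile1 // ltW.
(* The state after [n] rounds: intervals of stage [k + n] inside [[th, 1]]
   whose endpoints have products enclosing [x]. *)
pose good n (a : 'I_m.+1 -> R) :=
  [/\ forall i, cantor_left alpha (k + n) (a i),
      forall i, th <= a i /\ a i + lam ^+ (k + n) <= 1 &
      \prod_i a i <= x <= \prod_i (a i + lam ^+ (k + n))].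
have step (p : nat * ('I_m.+1 -> R)) : exists b : 'I_m.+1 -> bool,
    good p.1 p.2 -> good p.1.+1
      (fun i => p.2 i + (b i)%:R * ((1 - lam) * lam ^+ (k + p.1))).
  case: p => n a /=; case: (pselect (good n a)) => [[cl ab ax]|ng]; last first.
    by exists (fun=> false) => /ng.
  have [|b hb] := split_all _ _ _ _ _ _ _ (lk0 (k + n)%N) th0 hm' ab ax.
    by rewrite (ltW lam0) ltW.
  exists b => _; split.
  - by move=> i; rewrite addnS; apply: cantor_left_child.
  - move=> i; have [h1 h2] := ab i; split.
      by apply: le_trans h1 _; rewrite lerDl !mulr_ge0 // subr_ge0 ltW.
    apply: le_trans h2; rewrite addnS exprS -addrA lerD2l.
    have := lk0 (k + n)%N; have : lam * lam ^+ (k + n) <= lam ^+ (k + n).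
      by rewrite ler_piMl // ltW.
    by case: (b i) => /= ? ?; lra.
  - by rewrite addnS exprS.
have [f hf] := choice step.
pose a := fix a n := if n is n'.+1 then
   (fun i => a n' i + (f (n', a n') i)%:R * ((1 - lam) * lam ^+ (k + n')))
   else (fun=> th).
have ga n : good n (a n).
  elim: n => [|n IH]; last exact: (hf (n, a n)).
  split => /=; rewrite addn0.
  - by move=> i; exact: cantor_left_rightmost.
  - by move=> i; split => //; rewrite subrK.
  - have -> : th + lam ^+ k = 1 by rewrite subrK.
    by rewrite !prodr_const card_ord expr1n.
have /choice[c hc] (i : 'I_m.+1) : exists c : R, (fun n => a n i) @ \oo --> c /\
    forall n, a n i <= c <= a n i + lam ^+ n * lam ^+ k.
  apply: nested_intervals_point; rewrite ?(ltW lam0) //.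
  by move=> n; exists (f (n, a n) i); rewrite /= exprD [lam ^+ k * _]mulrC.
exists c; split.
  move=> i l _.
  have [_ hci] := hc i.
  (* A stage [l < k] is handled by its rightmost interval, which contains
     [[th, 1]]. *)
  have [lk|kl] := leqP k l; last first.
    exists (1 - ratio alpha ^+ l, 1 - ratio alpha ^+ l + ratio alpha ^+ l).
      exact: cantor_left_rightmost.
    rewrite /= in_itv /= subrK.
    have /= := hci 0%N; rewrite expr0 mul1r subrK => /andP[h1 ->]; rewrite andbT.
    apply: le_trans h1; rewrite lerD2l lerN2.
    by rewrite (ler_iXn2l lam0 lam1) ltnW.
  have [/(_ i) cl _ _] := ga (l - k)%N.
  rewrite subnKC // in cl.
  exists (a (l - k)%N i, a (l - k)%N i + ratio alpha ^+ l) => //.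
  by rewrite /= in_itv /=; have := hci (l - k)%N; rewrite -exprD subnK.
have mulc : continuous (fun z : R * R => z.1 * z.2) by exact: mul_continuous.
have cl : (fun n => \prod_i a n i) @ \oo --> \prod_i c i.
  by apply: (cvg_big mulc) => i _; have [] := hc i.
have cr : (fun n => \prod_i (a n i + lam ^+ n * lam ^+ k)) @ \oo --> \prod_i c i.
  apply: (cvg_big mulc) => i _.
  rewrite -[c i]addr0 -[X in _ + X](mul0r (lam ^+ k)).
  apply: cvgD; first by have [] := hc i.
  apply: cvgMl; apply: cvg_expr; rewrite ger0_norm //; exact: ltW.
apply/eqP; rewrite eq_le; apply/andP; split.
  apply: (cvgr_to_ge cr); near=> n.
  by have [_ _ /andP[_]] := ga n; rewrite addnC exprD.
apply: (cvgr_to_le cl); near=> n.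
by have [_ _ /andP[]] := ga n.
Unshelve. all: by end_near.
Qed.

(** * The tangency parameters *)

(** With [u = ln a], tangency at [x] means [x = s + 1 / (2 u)] and
    [2 u * expR ((2 s - 1) u + 1) = b], an equation solved by continuity. *)
Lemma tangent_exists {R : realType} (b s : R) : 0 < b -> 1 <= s ->
  exists a : R, 1 < a /\
    tangent_graphs (fun t => a `^ (2 * t - 1)) (fun t => b * (t - s)).
Proof.
move=> b0 s1.
pose h u := 2 * u * expR ((2 * s - 1) * u + 1).
have hc : continuous h.
  move=> u; apply: cvgM; first by apply: cvgM; [exact: cvg_cst|exact: cvg_id].
  apply: continuous_comp; last exact: continuous_expR.
  apply: cvgD; last exact: cvg_cst.
  by apply: cvgM; [exact: cvg_cst|exact: cvg_id].
have b20 : 0 <= b / 2 by lra.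
have h0 : h 0 = 0 by rewrite /h mulr0 mul0r.
have hb : b <= h (b / 2).
  rewrite /h (_ : 2 * (b / 2) = b); last by field.
  rewrite ler_peMr ?(ltW b0) // -[X in X <= _]expR0 ler_expR.
  have : 0 <= (2 * s - 1) * (b / 2) by apply: mulr_ge0 => //; lra.
  lra.
have [||u] := @IVT R h 0 (b / 2) b b20.
- exact: continuous_subspaceT.
- have hb0 := le_trans (ltW b0) hb.
  by rewrite h0 (min_idPl hb0) (max_idPr hb0) (ltW b0).
rewrite in_itv /= => /andP[u0 _] hu.
have {u0} u0 : 0 < u.
  rewrite lt_neqAle u0 andbT; apply/eqP => u0'.
  by move: b0; rewrite -hu -u0' h0 ltxx.
have fE : (fun t => (expR u) `^ (2 * t - 1)) = (fun t => expR (u * (2 * t - 1))).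
  by apply/funext => t; rewrite expRM.
exists (expR u); split; first by rewrite -expR0 ltr_expR.
rewrite fE; pose x := s + 1 / (2 * u).
have ex : expR (u * (2 * x - 1)) = b / (2 * u).
  rewrite (_ : u * (2 * x - 1) = (2 * s - 1) * u + 1); last first.
    by rewrite /x; field; rewrite gt_eqF.
  by rewrite -hu /h; field; rewrite gt_eqF.
have df : is_derive x 1 (fun t => expR (u * (2 * t - 1))) (b / (2 * u) * (2 * u)).
  apply: (@is_derive1_comp R expR (fun t => u * (2 * t - 1)) x).
    by rewrite -ex; exact: is_derive_expR.
  by apply: is_derive_eq; rewrite /GRing.scale /=; ring.
have dg : is_derive x 1 (fun t => b * (t - s)) b.
  by apply: is_derive_eq; rewrite /GRing.scale /=; ring.
exists x; split.
- by have [] := df.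
- by have [] := dg.
- by rewrite ex /x; field; rewrite gt_eqF.
- have [_ ef] := df; have [_ eg] := dg.
  by rewrite !derive1E ef eg; field; rewrite gt_eqF.
Qed.

Lemma beta_gt0 {R : realType} (alpha : R) : 1 / 3 < alpha < 1 -> 0 < beta alpha.
Proof. by move=> /andP[? ?]; rewrite /beta divr_gt0 //; nra. Qed.

(** Only the value at the tangency point matters below; its abscissa is to the
    right of the zero of the line since the exponential is nonnegative. *)
Lemma a0_spec {R : realType} : 1 < a0 R /\
  exists x : R, 1 <= x /\ a0 R `^ (2 * x - 1) = x - 1.
Proof.
have [|a1 [x [_ _ e _]]] := @xgetPex R 0 [set a : R | 1 < a /\
    tangent_graphs (fun t => a `^ (2 * t - 1)) (fun t => t - 1)].
  have [a [a1 ta]] := @tangent_exists R 1 1 ltr01 (lexx _).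
  exists a; split => //; rewrite (_ : (fun t => t - 1) = (fun t => 1 * (t - 1))) //.
  by apply/funext => t; rewrite mul1r.
split => //; exists x; split; last exact: e.
by rewrite -subr_ge0 -e powR_ge0.
Qed.

Lemma a1_spec {R : realType} (alpha : R) : 1 / 3 < alpha < 1 ->
  1 < a1 alpha /\
  exists x : R, 3 <= x /\ a1 alpha `^ (2 * x - 1) = beta alpha * (x - 3).
Proof.
move=> /beta_gt0 b0.
have [|a1 [x [_ _ e _]]] := @xgetPex R 0 [set a : R | 1 < a /\
    tangent_graphs (fun t => a `^ (2 * t - 1)) (fun t => beta alpha * (t - 3))].
  by apply: tangent_exists => //; lra.
split => //; exists x; split; last exact: e.
by rewrite -subr_ge0 -(pmulr_rge0 _ b0) -e powR_ge0.
Qed.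

(** The ceiling is taken of the real exponent [q] with [lam `^ q = 1 - 1 / a]. *)
Lemma ceil_ln_ratio {R : realType} (a lam : R) : 1 < a -> 0 < lam < 1 ->
  let k := `|Num.ceil (ln (1 - 1 / a) / ln lam)|%N in
  (0 < k)%N /\ 1 / a <= 1 - lam ^+ k.
Proof.
move=> a1 /andP[l0 l1] k.
have a0 : 0 < a by lra.
have ia : 0 < 1 / a < 1.
  by rewrite divr_gt0 //= ltr_pdivrMr // mul1r.
have lna : ln (1 - 1 / a) < 0 by apply: ln_lt0; lra.
have lnl : ln lam < 0 by apply: ln_lt0; rewrite l0.
pose q := ln (1 - 1 / a) / ln lam.
have q0 : 0 < q by rewrite /q nmulr_rgt0 // invr_lt0.
have ck : (k%:Z = Num.ceil q)%R.
  by rewrite /k gez0_abs // ltW // ceil_gt0.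
have qk : q <= k%:R by have := ceil_ge q; rewrite -ck.
split; first by rewrite -(ltr_nat R); apply: lt_le_trans qk.
rewrite lerBrDr addrC -lerBrDr -ler_ln ?posrE ?exprn_gt0 //; last by lra.
rewrite lnXn // -mulr_natl -ler_ndivrMr //.
Qed.

(** * Existence and size of the number of factors *)

(** A nondecreasing positive integer function lying below the identity at some
    positive point has a positive fixed point: the least point at which it lies
    below the identity. *)
Lemma prefixpoint_fixpoint (F : nat -> int) (n : nat) :
  (forall i, (0 < i)%N -> 0 < F i) ->
  {homo F : i j / (i <= j)%N >-> i <= j} -> (0 < n)%N -> F n <= n%:Z ->
  exists2 t : nat, (0 < t)%N & t%:Z == F t.
Proof.
move=> F0 Fm n0 Fn.
have ex : exists n : nat, (0 < n)%N && (F n <= n%:Z) by exists n; rewrite n0.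
case: (ex_minnP ex) => t /andP[t0 Ft] tmin; exists t => //.
rewrite eq_le Ft andbT -(gtz0_abs (F0 t t0)) lez_nat.
have le_t : (`|F t| <= t)%N by rewrite -lez_nat gtz0_abs // F0.
apply: tmin; rewrite absz_gt0 gt_eqF ?F0 //= gtz0_abs ?F0 //.
exact: Fm.
Qed.

Lemma k_of_spec {R : realType} (alpha : R) : 0 < alpha < 1 ->
  let a := if alpha <= 1 / 3 then a0 R else a1 alpha in
  (0 < k_of alpha)%N /\ 1 / a <= theta alpha.
Proof.
move=> /[dup] alpha01 /andP[al0 al1] a.
have /andP[l0 l1] := ratio_bounds _ alpha01.
have a_gt1 : 1 < a.
  rewrite /a; case: (leP alpha (1 / 3)) => h; first by have [] := @a0_spec R.
  by have [|//] := @a1_spec R alpha; rewrite h.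
by apply: ceil_ln_ratio; rewrite // l0; lra.
Qed.

Lemma theta_bounds {R : realType} (alpha : R) : 0 < alpha < 1 ->
  1 - ratio alpha <= theta alpha < 1.
Proof.
move=> alpha01; have /andP[l0 l1] := ratio_bounds _ alpha01.
have [k0 _] := k_of_spec _ alpha01.
rewrite /theta -/(ratio alpha); apply/andP; split; last first.
  by rewrite ltrBlDr ltrDl exprn_gt0.
rewrite lerD2l lerN2 -[leRHS]expr1 ler_iXn2l //; lra.
Qed.

Lemma inv_theta_exp_le {R : realType} (alpha x : R) (n : nat) : 0 < alpha < 1 ->
  let a := if alpha <= 1 / 3 then a0 R else a1 alpha in
  (0 < n)%N -> n%:R <= x ->
  1 / theta alpha ^+ (2 * n - 1) <= a `^ (2 * x - 1).
Proof.
move=> alpha01 a n0 nx.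
have /andP[al0 al1] := alpha01.
have /andP[l0 l1] := ratio_bounds _ alpha01.
have /andP[th0 _] := theta_bounds _ alpha01.
have [_] := k_of_spec _ alpha01; rewrite -/a => ath.
have th_gt0 : 0 < theta alpha by lra.
have a_gt1 : 1 < a.
  rewrite /a; case: (leP alpha (1 / 3)) => h; first by have [] := @a0_spec R.
  by have [|//] := @a1_spec R alpha; rewrite h.
have tha : 1 / theta alpha <= a.
  by rewrite ler_pdivrMr // mulrC -ler_pdivrMr //; lra.
apply: (@le_trans _ _ (a `^ (2 * n - 1)%N%:R)).
  rewrite powR_mulrn; last by lra.
  rewrite div1r -exprVn -div1r lerXn2r // nnegrE; last by lra.
  by rewrite divr_ge0 // ltW.
apply: ler_powR; first exact: ltW.
by rewrite natrB ?muln_gt0 // natrM; lra.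
Qed.

(** The right-hand side of the equation [t_equation]. *)
Definition t_rhs {R : realType} (alpha : R) (t : nat) : int :=
  let p := theta alpha ^+ (2 * t - 1) in
  if alpha <= 1 / 3 then Num.ceil (1 / p)
  else Num.ceil (1 / p) +
       Num.ceil (((3 * alpha - 1) / 2) / (p * ((1 - alpha ^+ 2) / 4))).

(** The witness is the integer part of the abscissa of the tangency point. *)
Lemma t_rhs_le {R : realType} (alpha : R) : 0 < alpha < 1 ->
  exists2 n : nat, (0 < n)%N & t_rhs alpha n <= n%:Z.
Proof.
move=> alpha01; have /andP[al0 al1] := alpha01.
rewrite /t_rhs; case: (leP alpha (1 / 3)) => h.
  have [_ [x [x1 ex]]] := @a0_spec R.
  have x0 : 0 <= x by lra.
  have /andP[nx xn] := truncn_itv x0.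
  have n0 : (0 < Num.trunc x)%N by rewrite truncn_gt0.
  exists (Num.trunc x) => //.
  have := inv_theta_exp_le _ _ _ alpha01 n0 nx.
  rewrite h ex => y; rewrite ceil_le_int; apply: le_trans y _.
  by rewrite -natr1 in xn; rewrite -pmulrn; lra.
have [|_ [x [x1 ex]]] := @a1_spec R alpha; first by rewrite h.
have x0 : 0 <= x by lra.
have /andP[nx xn] := truncn_itv x0.
have n0 : (0 < Num.trunc x)%N by rewrite truncn_gt0; lra.
exists (Num.trunc x) => //.
have := inv_theta_exp_le _ _ _ alpha01 n0 nx.
rewrite (leNgt alpha) h /= ex; set p := theta _ ^+ _ => y.
have /andP[l0 l1] := ratio_bounds _ alpha01.
have /andP[th0 _] := theta_bounds _ alpha01.
have p0 : 0 < p by rewrite exprn_gt0 //; lra.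
have D0 : 0 < 1 - alpha ^+ 2 by nra.
have N0 : 0 < 6 * alpha - 1 - alpha ^+ 2 by nra.
set z := _ / (p * _).
(* The sum of the two arguments is [1 / p] divided by [beta alpha]. *)
have yz : 1 / p + z <= x - 3.
  have -> : 1 / p + z = (1 / p) / beta alpha.
    by rewrite /z /beta; field; apply/and3P; split; exact: lt0r_neq0.
  rewrite ler_pdivrMr; first by rewrite [leRHS]mulrC.
  by apply: beta_gt0; rewrite h.
rewrite -(ler_int R) intrD.
have /andP[c1 _] := ceil_itv (1 / p); have /andP[c2 _] := ceil_itv z.
rewrite -natr1 in xn; rewrite !intrD in c1 c2; rewrite -pmulrn.
lra.
Qed.

Lemma t_rhs_homo {R : realType} (alpha : R) : 0 < alpha < 1 ->
  {homo t_rhs alpha : i j / (i <= j)%N >-> i <= j}.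
Proof.
move=> alpha01 i j ij; have /andP[al0 al1] := alpha01.
have /andP[l0 l1] := ratio_bounds _ alpha01.
have /andP[th0 th1] := theta_bounds _ alpha01.
have tp : 0 < theta alpha by lra.
have pij : theta alpha ^+ (2 * j - 1) <= theta alpha ^+ (2 * i - 1).
  by rewrite ler_iXn2l // leq_sub2r // leq_mul2l.
have ipij : (theta alpha ^+ (2 * i - 1))^-1 <= (theta alpha ^+ (2 * j - 1))^-1.
  by rewrite lef_pV2 // posrE exprn_gt0.
have c1 : Num.ceil (1 / theta alpha ^+ (2 * i - 1)) <=
          Num.ceil (1 / theta alpha ^+ (2 * j - 1)).
  by apply: le_ceil; rewrite !div1r.
rewrite /t_rhs; case: (leP alpha (1 / 3)) => // h; apply: lerD => //; apply: le_ceil.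
have D0 : 0 < (1 - alpha ^+ 2) / 4 by nra.
apply: ler_wpM2l; first by lra.
rewrite lef_pV2 ?posrE; last 2 first.
- by apply: mulr_gt0 => //; exact: exprn_gt0.
- by apply: mulr_gt0 => //; exact: exprn_gt0.
by rewrite ler_pM2r.
Qed.

Lemma t_rhs_bounds {R : realType} (alpha : R) (t : nat) : 0 < alpha < 1 ->
  (0 < t)%N ->
  2 <= t_rhs alpha t /\
  (1 / 3 < alpha ->
     2 + ((3 * alpha - 1) / 2) / ((1 - alpha ^+ 2) / 4) <= (t_rhs alpha t)%:~R).
Proof.
move=> alpha01 t0; have /andP[al0 al1] := alpha01.
have /andP[l0 l1] := ratio_bounds _ alpha01.
have /andP[th0 th1] := theta_bounds _ alpha01.
rewrite /t_rhs; set p := theta _ ^+ _.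
have p0 : 0 < p by rewrite exprn_gt0 //; lra.
have p1 : p < 1.
  by rewrite exprn_ilt1 //; [rewrite -lt0n subn_gt0; exact: (leq_mul (leqnn 2) t0)|lra].
have c1 : 2 <= Num.ceil (1 / p).
  by rewrite -[2]/(1 + 1 : int) lezD1 ceil_gt_int ltr_pdivlMr // mul1r.
case: (leP alpha (1 / 3)) => h; first by split => //; lra.
have D0 : 0 < (1 - alpha ^+ 2) / 4 by nra.
set N := (3 * alpha - 1) / 2; set D := _ / 4 in D0 *.
have ND : 0 <= N / D by rewrite divr_ge0 ?(ltW D0) // /N; lra.
have NpD : N / D <= (Num.ceil (N / (p * D)))%:~R.
  apply: le_trans (ceil_ge _); rewrite (invfM p) mulrCA ler_peMl //.
  by rewrite invf_ge1 // ltW.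
split.
  apply: le_trans c1 _; rewrite lerDl -(ler_int R).
  exact: le_trans ND _.
move=> _; rewrite intrD lerD //.
by move: c1; rewrite -(ler_int R).
Qed.

(** The defining property of [t_of] is satisfied, and not its default value. *)
Lemma t_of_spec {R : realType} (alpha : R) : 0 < alpha < 1 ->
  (0 < t_of alpha)%N /\ (t_of alpha)%:Z = t_rhs alpha (t_of alpha).
Proof.
move=> alpha01.
have pos t : (0 < t)%N -> 2 <= t_rhs alpha t.
  by move=> t0; have [] := t_rhs_bounds _ _ alpha01 t0.
have [n n0 hn] := t_rhs_le _ alpha01.
have [t t0 /eqP ht] : exists2 t : nat, (0 < t)%N & t%:Z == t_rhs alpha t.
  apply: (prefixpoint_fixpoint _ _ _ (t_rhs_homo _ alpha01) n0 hn) => i i0.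
  by apply: lt_le_trans (pos i i0).
have ex : exists t : nat, (0 < t)%N && (t%:Z == t_rhs alpha t).
  by exists t; rewrite t0 ht eqxx.
case: (ex_minnP ex) => u /andP[u0 /eqP ut] umin.
have [|? ? _] := @xgetPex nat 0%N [set t : nat | [/\ (0 < t)%N, t_equation alpha t &
    forall s : nat, (0 < s)%N -> t_equation alpha s -> (t <= s)%N]]; last by [].
exists u; split => // s s0 hs; apply: umin; rewrite s0; exact/eqP.
Qed.

(** The hypothesis of [prod_cantor] for [2 * t_of alpha] factors. *)
Lemma t_of_large {R : realType} (alpha : R) : 0 < alpha < 1 ->
  alpha <= (2 * t_of alpha - 1)%N%:R * ratio alpha * theta alpha.
Proof.
move=> alpha01; have /andP[al0 al1] := alpha01.
have /andP[th0 th1] := theta_bounds _ alpha01.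
have [t0 tE] := t_of_spec _ alpha01.
have [t2 tb] := t_rhs_bounds _ _ alpha01 t0.
move: (t_of alpha) t0 tE t2 tb => t t0 <- t2 tb.
have {t2} t2 : 2 <= t%:R :> R by move: t2; rewrite -(ler_int R).
rewrite natrB ?muln_gt0 // natrM.
set M := 2 * _ - 1.
have M3 : 3 <= M by rewrite /M; lra.
(* The bound [theta alpha >= 1 - ratio alpha] is used here. *)
suff h : alpha <= M * ((1 - alpha ^+ 2) / 4).
  apply: (le_trans h); rewrite -mulrA; apply: ler_wpM2l; first by lra.
  have -> : (1 - alpha ^+ 2) / 4 = ratio alpha * (1 - ratio alpha).
    by rewrite /ratio; field.
  by apply: ler_wpM2l => //; rewrite /ratio; lra.
have D0 : 0 < (1 - alpha ^+ 2) / 4 by nra.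
case: (leP alpha (1 / 3)) => h.
  apply: (@le_trans _ _ (3 * ((1 - alpha ^+ 2) / 4))); first by nra.
  by rewrite ler_pM2r.
have := tb h; rewrite -lerBrDl ler_pdivrMr // -pmulrn => hN.
have -> : M * ((1 - alpha ^+ 2) / 4) =
   3 * ((1 - alpha ^+ 2) / 4) + 2 * ((t%:R - 2) * ((1 - alpha ^+ 2) / 4)).
  by rewrite /M; field.
nra.
Qed.

Theorem theorem5 (R : realType) (alpha : R) (alpha01 : 0 < alpha < 1) :
  I_of alpha `<=` Gamma_of alpha.
Proof.
have /andP[l0 l1] := ratio_bounds _ alpha01.
have /andP[th0 th1] := theta_bounds _ alpha01.
have [t0 _] := t_of_spec _ alpha01.
have large := t_of_large _ alpha01.
move=> x; rewrite /I_of /= in_itv /= => /andP[xl xr].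
have tE : (2 * t_of alpha = (2 * t_of alpha - 1).+1)%N.
  by rewrite subn1 prednK // muln_gt0.
have hx : theta alpha ^+ (2 * t_of alpha - 1).+1 <= x <= 1.
  rewrite -tE; move: (theta alpha) (t_of alpha) th0 th1 t0 xl xr => th t ? ? ? xl xr.
  apply/andP; split.
    apply: (le_trans _ xl); rewrite ler_iXn2l //; last by lra.
    by rewrite mul2n -addnn leq_add2l.
  apply: (le_trans xr); apply: exprn_ile1; lra.
have [c [cC xc]] := prod_cantor alpha (k_of alpha) _ x alpha01 large hx.
rewrite /Gamma_of tE; exists c; split; [exact: cC|exact: xc].
Qed.
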